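(* Let $X=(\mathbf{x}_1,\dots,\mathbf{x}_n)$ be a nondegenerate configuration of $n$ distinct points in $\mathbb{R}^d$, and let $K=\operatorname{Conv}(X)$ be their convex hull, which has dimension $d$. For $\varepsilon>0$ let $\mathbf{f}_\varepsilon\colon\mathbb{S}^{d-1}\to\mathbb{R}^d$ be the map $\mathbf{f}_\varepsilon(\mathbf{n})=\sum_{i=1}^n\lambda_i(\varepsilon,\mathbf{n})\,\mathbf{x}_i$ defined in the context. Then, for every $\varepsilon>0$, the image of the unit sphere lies in the interior of the convex hull, $\mathbf{f}_\varepsilon(\mathbb{S}^{d-1})\subset K^\circ$, and moreover these images converge, as sets in $\mathbb{R}^d$, to the boundary of $K$: $$\lim_{\varepsilon\to0^+}\mathbf{f}_\varepsilon(\mathbb{S}^{d-1})=\partial K .$$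
   Context: A configuration $X=(\mathbf{x}_1,\dots,\mathbf{x}_n)$ of $n\ge d+1$ distinct points in $\mathbb{R}^d$ is nondegenerate if the points do not all lie on a proper affine subspace of $\mathbb{R}^d$. $K^\circ$ denotes the interior of $K$ and $\partial K$ its boundary in $\mathbb{R}^d$; $\mathbb{S}^{d-1}$ is the unit sphere of $\mathbb{R}^d$, with $\langle\cdot,\cdot\rangle$ and $\|\cdot\|$ the Euclidean inner product and norm. For $i\neq j$ set $\mathbf{n}_{ij}=\dfrac{\mathbf{x}_j-\mathbf{x}_i}{\|\mathbf{x}_j-\mathbf{x}_i\|}\in\mathbb{S}^{d-1}$. For $\varepsilon>0$ and $\mathbf{n}\in\mathbb{S}^{d-1}$ define $$c_{ij}(\varepsilon,\mathbf{n})=\varepsilon+\max\{0,-\langle\mathbf{n},\mathbf{n}_{ij}\rangle\}\ (i\neq j),\qquad c_i(\varepsilon,\mathbf{n})=\prod_{1\le j\le n,\ j\neq i}c_{ij}(\varepsilon,\mathbf{n}),$$ $$\lambda_i(\varepsilon,\mathbf{n})=\frac{c_i(\varepsilon,\mathbf{n})}{\sum_{j=1}^n c_j(\varepsilon,\mathbf{n})},\qquad \mathbf{f}_\varepsilon(\mathbf{n})=\sum_{i=1}^n\lambda_i(\varepsilon,\mathbf{n})\,\mathbf{x}_i .$$ Convergence as sets, $\lim_{\varepsilon\to0^+}\mathbf{f}_\varepsilon(\mathbb{S}^{d-1})=\partial K$, means that both of the following hold: (i) for every neighborhood $W\supset\partial K$ in $\mathbb{R}^d$ there is $\varepsilon_0>0$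 such that $\mathbf{f}_\varepsilon(\mathbb{S}^{d-1})\subset W$ for all $0<\varepsilon<\varepsilon_0$; (ii) for every $\mathbf{x}\in\partial K$ there exist points $\mathbf{y}_\varepsilon\in\mathbf{f}_\varepsilon(\mathbb{S}^{d-1})$, for $\varepsilon>0$, such that $\mathbf{y}_\varepsilon\to\mathbf{x}$ as $\varepsilon\to0^+$. *)

(* Defs.v *)
From mathcomp Require Import all_boot all_order all_algebra.
From mathcomp Require Import all_classical all_reals all_analysis.
Import Order.TTheory GRing.Theory Num.Theory.
Import numFieldNormedType.Exports.

Set Implicit Arguments.
Unset Strict Implicit.
Unset Printing Implicit Defensive.

Local Open Scope classical_set_scope.
Local Open Scope ring_scope.

Section EuclideanSpace.
Context {R : realType} {d : nat}.
Implicit Types (u v p : 'rV[R]_d) (A B : set 'rV[R]_d).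

Definition dotmul u v : R := \sum_(k < d) u 0 k * v 0 k.

(* The library norm `|u| on 'rV[R]_d is the maximum norm; it induces the same
   topology, so library notions such as closure and interior can be used. *)
Definition enorm u : R := Num.sqrt (dotmul u u).

Definition unit_sphere : set 'rV[R]_d := [set u | enorm u = 1].

Definition boundary A : set 'rV[R]_d := closure A `\` A°.

Definition affine_of p (V : {vspace 'rV[R]_d}) : set 'rV[R]_d :=
  [set y | y - p \in V].

Definition affine_subspace A : Prop := exists p V, A = affine_of p V.

Definition affine_hull A : set 'rV[R]_d := smallest affine_subspace A.

Definition has_affine_dim A (k : nat) : Prop :=
  exists p (V : {vspace 'rV[R]_d}), affine_hull A = affine_of p V /\ \dim V = k.

Definition convex_hull A : set 'rV[R]_d :=
  smallest (@convex_set R 'rV[R]_d) A.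

(* [set_nbhs B W] says that W is a neighborhood of every point of B, i.e. that
   W contains an open set containing B. *)
Definition sets_converge_at_right0 (A : R -> set 'rV[R]_d) B : Prop :=
  (forall W, set_nbhs B W ->
     exists2 e0 : R, 0 < e0 & forall e, 0 < e < e0 -> A e `<=` W) /\
  (forall x, B x ->
     exists2 y : R -> 'rV[R]_d,
       (forall e, 0 < e -> A e (y e)) & y e @[e --> 0^'+] --> x).

End EuclideanSpace.

Section Configuration.
Context {R : realType} {n d : nat} (x : 'I_n -> 'rV[R]_d).
Implicit Types (e : R) (u : 'rV[R]_d) (i j : 'I_n).

Definition nondegenerate_config : Prop :=
  forall A : set 'rV[R]_d,
    affine_subspace A -> A != setT -> ~ (range x `<=` A).

Definition unit_dir i j : 'rV[R]_d :=
  (enorm (x j - x i))^-1 *: (x j - x i).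

Definition c_pair e u i j : R := e + Num.max 0 (- dotmul u (unit_dir i j)).

Definition c_point e u i : R := \prod_(j < n | j != i) c_pair e u i j.

Definition lambda_weight e u i : R := c_point e u i / \sum_(j < n) c_point e u j.

Definition f_eps e u : 'rV[R]_d := \sum_(i < n) lambda_weight e u i *: x i.

End Configuration.

(* Main.v *)
Require Import Defs.
From mathcomp Require Import all_boot zify.

(** Why the theorem holds. All the weights are positive, and for a
    nondegenerate configuration a combination of the points with positive
    weights is an interior point of the hull K (interior_sum_gt0). This gives
    the inclusion of the images in the interior.

    The convergence rests on one uniform inequality (support_gap, hull_gap):
    for some constant C, in every direction u the point f_eps x e u is within
    C e of the supporting hyperplane of K orthogonal to u. A point with a ball
    of radius r inside K around it is farther than r / 2 from all the
    supporting hyperplanes, so for small e no value of f_eps x e can be such a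
    point; by compactness the values enter every neighborhood of the boundary.

    Conversely, let b be a boundary point and o an interior point of K. For
    small e the same inequality shows that f_eps x e u - o has a positive scalar
    product with u, for every unit vector u. A continuous map from the sphere
    with this property meets every ray from the origin (sphere_hits_ray), so
    some value f_eps x e u lies on the ray from o through b. Being within C e of
    a supporting hyperplane, it is within a constant times e of b.

    That a map of the sphere which points outward everywhere meets every ray is
    a form of Brouwer's fixed point theorem. The latter is deduced here from
    Scarf's combinatorial lemma (scarf), which is about a finite set with
    finitely many total orders and is proved by counting rooms and doors
    modulo 2, as in Sperner's lemma. For the orders by coordinates on the
    lattice points of a dilated simplex it yields small cells that show all the
    colors, up to vanishing coordinates (scarf_grid), and a limit of such cells
    is a fixed point (brouwer). *)

Set Implicit Arguments.
Unset Strict Implicit.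
Unset Printing Implicit Defensive.

(** * Scarf's lemma *)

Section Scarf.
Variables (T I : finType) (r : I -> T -> nat).
Hypothesis r_inj : forall i, injective (r i).

(** Scarf's notion: no point of T beats, in every order at once, the worst
    member of S. For lattice points ordered by their coordinates, it makes the
    sum of the worst coordinates of S nearly maximal, and so S small. *)
Definition dominant (S : {set T}) : bool :=
  [forall y, exists i, [forall x in S, r i y <= r i x]].

Lemma dominantP (S : {set T}) :
  reflect (forall y, exists i, forall x, x \in S -> r i y <= r i x)
          (dominant S).
Proof.
apply: (iffP forallP) => H y; have := H y.
  by move=> /existsP[i /forall_inP Hi]; exists i.
by move=> [i Hi]; apply/existsP; exists i; apply/forall_inP.
Qed.

Lemma dominantS (S S' : {set T}) : S' \subset S -> dominant S -> dominant S'.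
Proof.
move=> /subsetP sS /dominantP dS; apply/dominantP => y.
by have [i Hi] := dS y; exists i => x /sS/Hi.
Qed.

(** Applying dominance to the members of S themselves shows that each of them is
    the worst one for some order, so S has at most #|I| members and the defect
    #|I| - #|S| counts the coincidences among the minima. *)
Lemma dominant_argmin (S : {set T}) (x0 : T) : x0 \in S -> dominant S ->
  exists2 m : I -> T, (forall i, m i \in S /\ forall x, x \in S -> r i (m i) <= r i x)
    & m @: setT = S.
Proof.
move=> x0S /dominantP dS.
pose m i := [arg min_(x < x0 in S) r i x].
have mP i : m i \in S /\ forall x, x \in S -> r i (m i) <= r i x.
  by rewrite /m; case: arg_minnP => // x xS xmin; split.
exists m => //; apply/setP => y; apply/imsetP/idP => [[i _ ->]|yS].
  by case: (mP i).
have [i Hi] := dS y; exists i => //.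
apply: (@r_inj i); apply/eqP; rewrite eqn_leq Hi ?(mP i).1 //.
exact: (mP i).2.
Qed.

Variable slack : I -> T.
(** The slack points play the part of the facets of a simplex: the i-th one is
    the worst point for the order i and better than all the proper points for
    the other orders. *)
Hypothesis slack_min : forall i y, r i (slack i) <= r i y.
Hypothesis slack_big : forall i k x, i != k -> x \notin codom slack -> r k x < r k (slack i).

Variable color : T -> I.
Hypothesis slackK : cancel slack color.

Lemma slack_inj : injective slack. Proof. exact: can_inj slackK. Qed.

Variable i0 : I.

(** Rooms and doors are the full and the almost full cells of Sperner's argument;
    only the doors that miss the color i0 are counted. *)
Definition room (S : {set T}) := dominant S && (#|S| == #|I|).
Definition door (D : {set T}) :=
  [&& dominant D, color @: D == [set~ i0] & #|D| == #|I|.-1].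

Lemma card_pos : 0 < #|I|. Proof. by apply/card_gt0P; exists i0. Qed.

Lemma roomU1 (D S : {set T}) : door D -> room S -> D \subset S ->
  exists2 x, x \notin D & S = x |: D.
Proof.
move=> /and3P[_ _ /eqP cD] /andP[_ /eqP cS] DS.
have: #|S :\: D| == 1.
  by rewrite cardsD (setIidPr DS) cD cS -subn1 subKn ?card_pos.
move=> /cards1P[x Sx]; have: x \in S :\: D by rewrite Sx inE.
rewrite inE => /andP[xD xS]; exists x => //.
by rewrite -Sx setUC -{1}(setID S D) (setIidPr DS).
Qed.

Lemma roomU1E (D : {set T}) x : door D -> x \notin D ->
  room (x |: D) = dominant (x |: D).
Proof.
move=> /and3P[_ _ /eqP cD] xD; rewrite /room cardsU1 xD cD add1n.
by rewrite (ltn_predK card_pos) eqxx andbT.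
Qed.

Definition outside := slack @: [set~ i0].

Lemma outsideP x : reflect (exists2 j, j != i0 & x = slack j) (x \in outside).
Proof.
by apply: (iffP imsetP) => -[j]; rewrite ?inE => j0 ->; exists j; rewrite ?inE.
Qed.

Lemma outside_le y x : y \notin outside -> x \in outside -> r i0 y <= r i0 x.
Proof.
move=> yD /outsideP[j j0 ->].
have [/codomP[k yk]|yc] := boolP (y \in codom slack); last exact/ltnW/slack_big.
have [k0|k0] := eqVneq k i0; first by rewrite yk k0 slack_min.
by case/negP: yD; apply/outsideP; exists k.
Qed.

Lemma dominant_outsideU x : (forall y, y \notin outside -> r i0 y <= r i0 x) ->
  dominant (x |: outside).
Proof.
move=> xmax; apply/dominantP => y.
have [/outsideP[j j0 ->]|yD] := boolP (y \in outside).
  by exists j => z _; apply: slack_min.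
exists i0 => z; rewrite in_setU1 => /orP[/eqP ->|]; first exact: xmax.
exact: outside_le.
Qed.

(** The slack points other than the i0-th form a door, and it is the only one
    on the boundary. *)
Lemma outside_door : door outside.
Proof.
apply/and3P; split.
- apply: (@dominantS ([arg max_(x > slack i0 | x \notin outside) r i0 x] |: outside)).
    exact: subsetUr.
  apply: dominant_outsideU; case: arg_maxnP => //.
  by apply/outsideP => -[j /negP j0 /slack_inj ji]; apply: j0; rewrite ji.
- rewrite -imset_comp (eq_imset _ (_ : color \o slack =1 id)) ?imset_id //.
- by rewrite card_imset ?cardsC1 //; apply: slack_inj.
Qed.

(** Only the best point for the order i0 can complete the outside door. *)
Lemma outside_room : #|[set S | room S & outside \subset S]| = 1.
Proof.
have s0 : slack i0 \notin outside.
  by apply/outsideP => -[j /negP j0 /slack_inj ji]; apply: j0; rewrite ji.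
set x := [arg max_(x > slack i0 | x \notin outside) r i0 x].
have [xD xmax] : x \notin outside /\ forall y, y \notin outside -> r i0 y <= r i0 x.
  by rewrite /x; case: arg_maxnP.
suff -> : [set S | room S & outside \subset S] = [set x |: outside] by rewrite cards1.
apply/setP => S; rewrite !inE; apply/andP/eqP => [[rS DS]|->]; last first.
  by rewrite subsetUr roomU1E ?outside_door //; split => //; apply: dominant_outsideU.
have [z zD SE] := roomU1 outside_door rS DS.
rewrite SE; congr (_ |: _); apply: (@r_inj i0); apply/eqP; rewrite eqn_leq xmax //=.
have /dominantP/(_ x)[k Hk] : dominant (z |: outside).
  by rewrite -SE; case/andP: rS.
have [k0|k0] := eqVneq k i0; first by rewrite -k0 Hk ?setU11.
case/negP: xD; apply/outsideP; exists k => //; apply: (@r_inj k); apply/eqP.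
rewrite eqn_leq slack_min Hk // in_setU1; apply/orP; right.
by apply/outsideP; exists k.
Qed.

(** A door that consists of slack points shows all the colors but i0, and slack
    points carry their own index as color. *)
Lemma door_nonslack (D : {set T}) : door D -> D != outside ->
  exists2 x0, x0 \in D & x0 \notin codom slack.
Proof.
move=> /and3P[_ /eqP cD /eqP card_D]; have [/exists_inP[x]|] :=
  boolP [exists x in D, x \notin codom slack]; first by move=> *; exists x.
rewrite negb_exists_in => /forall_inP DsS /negP[].
rewrite eqEcard card_D card_imset ?cardsC1 ?leqnn ?andbT; last exact: slack_inj.
apply/subsetP => x xD; have := DsS x xD; rewrite negbK => /codomP[j xj].
apply/outsideP; exists j => //.
have : color x \in [set~ i0] by rewrite -cD imset_f.
by rewrite xj slackK !inE.
Qed.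

(** A door D has one member less than there are orders, so exactly two orders
    i and j share their worst member. A room above D adds a point which becomes
    the worst one for i or for j. In the first case it has to be the best, for
    i, among the points that beat the minima of all the other orders, and such
    points exist because the i-th slack point is one of them. The case of j
    gives a second room, different from the first. *)
Lemma inner_room (D : {set T}) : door D -> D != outside ->
  #|[set S | room S & D \subset S]| = 2.
Proof.
move=> dD DO; have [x0 x0D x0s] := door_nonslack dD DO.
have [domD cD card_D] := and3P dD.
have [m mP mD] := dominant_argmin x0D domD.
have [i [j [ij mij]]] : exists i j, i != j /\ m i = m j.
  have : ~~ injectiveb m.
    apply/negP => /injectiveP m_inj; have := card_imset [set: I] m_inj; rewrite mD cardsT.
    by rewrite (eqP card_D) => /eqP; rewrite -(ltn_predK card_pos) /= ltn_eqF.
  by case/injectivePn => i [j]; exists i, j.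
have m_inj a b : a != b -> m a = m b -> {in [set~ a] &, injective m}.
  move=> ab mab; apply/imset_injP/eqP.
  have -> : m @: [set~ a] = D.
    apply/setP => y; rewrite -mD; apply/imsetP/imsetP => -[k _ ->]; first by exists k.
    have [->|ka] := eqVneq k a; last by exists k; rewrite ?inE.
    by exists b; rewrite ?inE // eq_sym.
  by rewrite cardsC1; exact/eqP.
(* The points of M a may replace m a as the worst member for the order a. *)
pose M a := [set y | [forall (k | k != a), r k (m k) < r k y]].
pose X a := [arg max_(y > slack a in M a) r a y].
have sM a : slack a \in M a.
  rewrite inE; apply/forall_inP => k ka.
  apply: (leq_ltn_trans ((mP k).2 _ x0D)); apply: slack_big => //.
  by rewrite eq_sym.
have XM a k : k != a -> r k (m k) < r k (X a).
  rewrite /X; case: arg_maxnP => // y; rewrite inE => /forall_inP + _; exact.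
have Xmax a y : y \in M a -> r a y <= r a (X a).
  by rewrite /X; case: arg_maxnP => // z _; apply.
have XD a b : a != b -> m a = m b -> X a \notin D.
  move=> ab mab; rewrite -mD; apply/negP => /imsetP[k _ Xk].
  have [ka|ka] := eqVneq k a; last by have := XM _ _ ka; rewrite -Xk ltnn.
  have ba : b != a by rewrite eq_sym.
  by have := XM a b ba; rewrite Xk ka mab ltnn.
have Xdom a b : a != b -> m a = m b -> dominant (X a |: D).
  move=> ab mab; apply/dominantP => y.
  have [yM|] := boolP (y \in M a).
    exists a => x; rewrite in_setU1 => /orP[/eqP ->|]; first exact: Xmax.
    move: x; have /dominantP/(_ y)[k Hk] := domD.
    have [<-//|ka] := eqVneq k a.
    move: yM; rewrite inE => /forall_inP/(_ k ka).
    by rewrite ltnNge Hk // (mP k).1.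
  rewrite inE negb_forall_in => /exists_inP[k ka]; rewrite -leqNgt => yk.
  exists k => x; rewrite in_setU1 => /orP[/eqP ->|xD].
    by apply: leq_trans yk _; apply/ltnW/XM.
  by apply: leq_trans yk _; apply: (mP k).2.
have XX : X i != X j.
  apply/eqP => Xij; have /dominantP/(_ (X i))[k Hk] := domD.
  have := Hk (m k) (mP k).1; apply/negP; rewrite -ltnNge.
  have [ki|] := eqVneq k i; last exact: XM.
  by rewrite Xij; apply: XM; rewrite ki.
have -> : [set S | room S & D \subset S] = [set X i |: D; X j |: D].
  apply/setP => S; rewrite !inE; apply/andP/idP => [[rS DS]|]; last first.
    have ji : j != i by rewrite eq_sym.
    case/orP => /eqP ->; rewrite subsetUr roomU1E ?(XD i j) ?(XD j i) //.
      by rewrite (Xdom i j).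
    by rewrite (Xdom j i).
  have [x xD SE] := roomU1 dD rS DS.
  have /andP[dS /eqP cS] := rS.
  have xS : x \in S by rewrite SE setU11.
  have [m' m'P m'S] := dominant_argmin xS dS.
  have m'_inj : injective m'.
    move=> u v; apply: (@imset_injP _ _ m' [set: I] _); rewrite ?inE //.
    by rewrite m'S cS cardsT.
  have [a _ xa] : exists2 a, a \in setT & x = m' a by apply/imsetP; rewrite m'S.
  have mE k : k != a -> m' k = m k.
    move=> ka; apply: (@r_inj k); apply/eqP; rewrite eqn_leq.
    rewrite (m'P k).2 ?(subsetP DS) ?(mP k).1 //= (mP k).2 //.
    have := (m'P k).1; rewrite {1}SE in_setU1 => /orP[|//].
    by rewrite xa => /eqP/m'_inj/eqP; rewrite (negPf ka).
  have aij : (a == i) || (a == j).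
    apply: contraT; rewrite negb_or => /andP[ai aj].
    case/negP: ij; apply/eqP/m'_inj.
    by rewrite !mE // eq_sym.
  suff xXa : x = X a by rewrite SE xXa; case/orP: aij => /eqP <-; rewrite eqxx ?orbT.
  apply: (@r_inj a); apply/eqP; rewrite eqn_leq Xmax /=; last first.
    rewrite inE; apply/forall_inP => k ka; rewrite -mE // ltn_neqAle.
    rewrite (m'P k).2 // andbT; apply: contra ka => /eqP/r_inj.
    by rewrite xa => /m'_inj ->.
  have /dominantP/(_ (X a))[k Hk] := dS.
  have [ka|ka] := eqVneq k a; first by move: Hk; rewrite ka; apply.
  have := Hk (m k) (subsetP DS _ (mP k).1); apply: contraTT => _.
  by rewrite -ltnNge XM.
rewrite cards2; case: eqP => // E.
have : X i \in X j |: D by rewrite -E setU11.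
by rewrite in_setU1 (negPf XX) (negPf (XD i j ij mij)).
Qed.

(** A room with all the colors has one door, obtained by removing its point of
    color i0. Any other room with a door shows all the colors but i0, and one of
    them twice: it has two doors. *)
Lemma room_doors (S : {set T}) : room S ->
  odd #|[set D | door D & D \subset S]| = (color @: S == setT).
Proof.
move=> /andP[dS /eqP cS].
pose U := [set x in S | color @: (S :\ x) == [set~ i0]].
have -> : #|[set D | door D & D \subset S]| = #|U|.
  rewrite -(@card_in_imset _ _ (fun x => S :\ x) (mem U)).
    apply: eq_card => D; rewrite inE; apply/andP/imsetP => [[dD DS]|[x]].
      have rS : room S by rewrite /room dS cS eqxx.
      have [x xD SE] := roomU1 dD rS DS; exists x.
        by rewrite inE SE setU11 setU1K //; case/and3P: dD.
      by rewrite SE setU1K.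
    rewrite inE => /andP[xS cx] ->; rewrite subD1set; split => //.
    apply/and3P; split => //; first exact: dominantS (subD1set _ _) dS.
    by rewrite -cS (cardsD1 x S) xS.
  move=> x y; rewrite !inE => /andP[xS _] /andP[yS _] /setP/(_ x).
  by rewrite !inE eqxx xS !andbT /= => /esym/negbFE/eqP.
have [cST|cST] := eqVneq (color @: S) setT.
  have c_inj : {in S &, injective color} by apply/imset_injP; rewrite cST cardsT cS.
  have /imsetP[x xS i0x] : i0 \in color @: S by rewrite cST.
  suff -> : U = [set x] by rewrite cards1.
  apply/setP => y; rewrite !inE; apply/andP/eqP => [[yS /eqP cy]|->].
    apply/eqP; apply: contraT => yx.
    have : i0 \in [set~ i0]; last by rewrite !inE eqxx.
    by rewrite -cy i0x imset_f // !inE eq_sym yx.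
  split=> //; apply/eqP/setP => k; rewrite !inE i0x.
  apply/imsetP/idP => [[z]|kx].
    by rewrite !inE => /andP[zx zS] ->; apply: contra zx => /eqP/c_inj ->.
  have /imsetP[z zS kz] : k \in color @: S by rewrite cST.
  by exists z => //; rewrite !inE zS andbT; apply: contra kx => /eqP <-; rewrite kz.
case: (set_0Vmem U) => [->|[x]]; first by rewrite cards0.
rewrite inE => /andP[xS /eqP cx].
have SD : #|S :\ x| = #|I|.-1 by rewrite -cS (cardsD1 x S) xS.
have c_inj : {in S :\ x &, injective color} by apply/imset_injP; rewrite cx cardsC1 SD.
have cxi0 : color x != i0.
  apply: contra cST => /eqP cxi; apply/eqP/setP => k; rewrite inE.
  have [->|k0] := eqVneq k i0; first by rewrite -cxi imset_f.
  have : k \in color @: (S :\ x) by rewrite cx !inE.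
  by apply/subsetP/imsetS/subD1set.
have /imsetP[y ySx cxy] : color x \in color @: (S :\ x) by rewrite cx !inE.
have := ySx; rewrite !inE => /andP[yx yS].
suff -> : U = [set x; y] by rewrite cards2 eq_sym yx.
apply/setP => z; rewrite !inE; apply/andP/orP => [[zS /eqP cz]|].
  have [->|zx] := eqVneq z x; first by left.
  right; apply/eqP; have zSx : z \in S :\ x by rewrite !inE zx.
  have /imsetP[w wSz czw] : color z \in color @: (S :\ z).
    by rewrite cz -cx imset_f.
  move: wSz; rewrite !inE => /andP[wz wS].
  have [wx|wx] := eqVneq w x; first by apply: c_inj; rewrite // czw wx cxy.
  by case/negP: wz; apply/eqP/c_inj; rewrite // !inE wx.
case=> /eqP ->; first by split => //; apply/eqP.
split => //; apply/eqP; rewrite -cx; apply/setP => k; apply/imsetP/imsetP => -[w].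
  rewrite !inE => /andP[wy wS] ->.
  have [->|wx] := eqVneq w x; first by exists y.
  by exists w; rewrite // !inE wx.
rewrite !inE => /andP[wx wS] ->.
have [->|wy] := eqVneq w y; first by exists x; rewrite // !inE xS eq_sym yx.
by exists w; rewrite // !inE wy.
Qed.

(** Counting the incident pairs of a door and a room by rooms gives, modulo 2, the
    number of rooms with all the colors; counting by doors gives 1, from the
    outside door. *)
Lemma scarf : exists2 S, dominant S & color @: S = setT.
Proof.
suff /card_gt0P[S] : 0 < #|[set S | room S & color @: S == setT]|.
  by rewrite inE => /andP[/andP[dS _] /eqP cS]; exists S.
apply: odd_gt0.
have E : \sum_(S | room S) #|[set D | door D & D \subset S]| =
         \sum_(D | door D) #|[set S | room S & D \subset S]|.
  transitivity (\sum_(S | room S) \sum_(D | door D) (D \subset S)).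
    by apply: eq_bigr => S _; rewrite -big_mkcondr sum1dep_card.
  rewrite exchange_big; apply: eq_bigr => D _.
  by rewrite -big_mkcondr sum1dep_card.
have -> : odd #|[set S | room S & color @: S == setT]| =
          odd (\sum_(S | room S) #|[set D | door D & D \subset S]|).
  rewrite -sum1dep_card big_mkcondr /=.
  elim/big_rec2: _ => // S a b rS; rewrite !oddD room_doors // => ->.
  by case: (_ == _).
rewrite E (bigD1 outside) ?outside_door //= outside_room oddD.
rewrite (eq_bigr (fun=> 2)); last by move=> D /andP[]; exact: inner_room.
by rewrite sum_nat_const oddM andbF.
Qed.

End Scarf.

(** * Small multicolored cells in the lattice simplex *)

Section Grid.
Variables (I : finType) (N : nat).

(** The lattice points of the N-th dilate of the standard simplex. *)
Definition grid_point := {x : {ffun I -> 'I_N.+1} | \sum_i x i == N}.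

Lemma grid_pointP (f : {ffun I -> nat}) : \sum_i f i = N ->
  exists g : grid_point, forall i, val g i = f i :> nat.
Proof.
move=> fN; pose g := [ffun i => inord (f i) : 'I_N.+1].
have gE i : g i = f i :> nat.
  by rewrite ffunE inordK // ltnS -fN (bigD1 i) //= leq_addr.
have gN : \sum_i g i == N by rewrite -[X in _ == X]fN; apply/eqP/eq_bigr.
by exists (exist _ g gN).
Qed.

Definition grid_fun (g : grid_point) : {ffun I -> nat} := [ffun i => val g i : nat].

Lemma sum_grid_fun g : \sum_i grid_fun g i = N.
Proof. by rewrite -[RHS](eqP (valP g)); apply: eq_bigr => i _; rewrite ffunE. Qed.

(** The coordinate functions, shifted by one so as to leave the bottom value to
    the slack element of the order and the top value to the other ones. *)
Definition height (k : I) (t : grid_point + I) : nat :=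
  match t with inl g => (grid_fun g k).+1 | inr i => if i == k then 0 else N.+2 end.

(** Ties between equal heights are broken by an enumeration. *)
Definition rank (k : I) (t : grid_point + I) : nat :=
  height k t * #|{: grid_point + I}| + enum_rank t.

Lemma rank_height k t u : rank k t <= rank k u -> height k t <= height k u.
Proof.
apply: contraTT; rewrite -!ltnNge => htu; rewrite /rank.
apply: (@leq_trans ((height k u).+1 * #|{: grid_point + I}|)).
  by rewrite mulSn addnC ltn_add2r ltn_ord.
by apply: leq_trans (leq_addr _ _); rewrite leq_mul2r htu orbT.
Qed.

Lemma height_rank k t u : height k t < height k u -> rank k t < rank k u.
Proof. by apply: contraTT; rewrite -!leqNgt; exact: rank_height. Qed.

Lemma rank_inj k : injective (rank k).
Proof.
move=> t u rtu; apply/enum_rank_inj/val_inj => /=.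
have htu : height k t = height k u.
  by apply/eqP; rewrite eqn_leq !rank_height ?rtu.
by move: rtu; rewrite /rank htu => /addnI.
Qed.

(** Let C be the set of the indices whose slack point is not in the dominant set,
    and mu the coordinatewise minimum of its lattice points. If the numbers
    mu i + 1 for i in C had a sum at most N, then some lattice point would
    exceed all the minima over C, against dominance. Hence the coordinates in C
    of the lattice points of the set stay within #|I| of the minima, and the
    other coordinates stay below #|I|. Each i in C is the color of one of
    these lattice points, because its slack point is absent. *)
Lemma scarf_grid (i0 : I) (c : {ffun I -> nat} -> I) :
  exists2 z : {ffun I -> nat}, \sum_i z i = N &
  forall i, z i <= #|I| \/
    exists x : {ffun I -> nat}, [/\ \sum_k x k = N, c x = i &
      forall k, x k <= z k + #|I| /\ z k <= x k + #|I|].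
Proof.
pose c' (t : grid_point + I) := match t with inl g => c (grid_fun g) | inr i => i end.
have [] := @scarf _ _ rank rank_inj inr _ _ c' _ i0.
- move=> i y; rewrite leq_eqVlt; apply/orP.
  have [<-|iy] := eqVneq (inr i) y; [by left | right].
  apply: height_rank; rewrite /= eqxx.
  case: y iy => [g //|j] /= ij; case: eqP => // ji.
  by case/eqP: ij; rewrite ji.
- move=> i k [g|j] ik; last by rewrite codom_f.
  move=> _; apply: height_rank; rewrite /= (negPf ik) !ltnS.
  by rewrite -[leqRHS](sum_grid_fun g) (bigD1 k) //= leq_addr.
- by [].
move=> S /dominantP domS cS.
have Hdom (f : {ffun I -> nat}) : \sum_i f i = N ->
    exists2 i, inr i \notin S & forall x, inl x \in S -> f i <= grid_fun x i.
  move=> /grid_pointP[g gf]; have [i Hi] := domS (inl g); exists i.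
    by apply/negP => /Hi/rank_height; rewrite /= eqxx.
  by move=> x /Hi/rank_height; rewrite /= ltnS ffunE gf.
have Hcol i : inr i \notin S -> exists2 g, inl g \in S & c (grid_fun g) = i.
  have : i \in c' @: S by rewrite cS.
  by case/imsetP => -[g gS ->|j jS ->]; [exists g | rewrite jS].
have [i1 i1S _] : exists2 i, inr i \notin S &
    forall x, inl x \in S -> (if i == i0 then N else 0) <= grid_fun x i.
  have [|i iS Hi] := Hdom [ffun i => if i == i0 then N else 0].
    by under eq_bigr do rewrite ffunE; rewrite -big_mkcond big_pred1_eq.
  by exists i => // x xS; have := Hi x xS; rewrite ffunE.
have [z zS _] := Hcol _ i1S.
pose m i := [arg min_(x < z | inl x \in S) grid_fun x i].
pose mu i := grid_fun (m i) i.
have muP i x : inl x \in S -> mu i <= grid_fun x i.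
  by rewrite /mu /m; case: arg_minnP => // y _; apply.
have mS i : inl (m i) \in S by rewrite /m; case: arg_minnP.
pose C i := inr i \notin S.
have sum_mu : N < \sum_(i | C i) (mu i).+1.
  rewrite ltnNge; apply/negP => le_N.
  pose f := [ffun i => (if C i then (mu i).+1 else 0) +
              (if i == i1 then N - \sum_(i | C i) (mu i).+1 else 0)].
  have [|i iS /(_ _ (mS i))] := Hdom f.
    under eq_bigr do rewrite ffunE; rewrite big_split /= -!big_mkcond big_pred1_eq.
    by rewrite subnKC.
  by rewrite ffunE /C iS addSn ltnNge leq_addr.
have sum_muE : \sum_(i | C i) (mu i).+1 <= \sum_(i | C i) mu i + #|I|.
  under eq_bigr do rewrite -addn1.
  by rewrite big_split /= leq_add2l sum1_card max_card.
have xN x : inl x \in S -> \sum_(i | C i) grid_fun x i + \sum_(i | ~~ C i) grid_fun x i = N.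
  by move=> xS; rewrite -[RHS](sum_grid_fun x) [RHS](bigID C).
have le_mu x : inl x \in S -> \sum_(i | C i) mu i <= \sum_(i | C i) grid_fun x i.
  by move=> xS; apply: leq_sum => i _; apply: muP.
have outC x i : inl x \in S -> ~~ C i -> grid_fun x i <= #|I|.
  move=> xS iC; have := xN x xS; have := le_mu x xS.
  move: sum_mu sum_muE; rewrite (bigD1 i (P := fun i => ~~ C i)) //=.
  move: (\sum_(_ | _) mu _) (\sum_(_ | _) _.+1) (\sum_(_ | C _) grid_fun x _).
  lia.
have inC x i : inl x \in S -> C i -> grid_fun x i <= mu i + #|I|.
  move=> xS iC; have := xN x xS; move: sum_mu sum_muE.
  rewrite !(bigD1 i (P := C)) //=.
  have : \sum_(j | C j && (j != i)) mu j <= \sum_(j | C j && (j != i)) grid_fun x j.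
    by apply: leq_sum => j _; apply: muP.
  move: (\sum_(_ | _) mu _) (\sum_(_ | _) _.+1) (\sum_(_ | ~~ C _) _).
  move: (\sum_(_ | _) _) => *; lia.
exists (grid_fun z); first exact: sum_grid_fun.
move=> i; have [iC|/(outC _ _ zS)] := boolP (C i); last by left.
right; have [x xS xi] := Hcol i iC; exists (grid_fun x); split=> //.
  exact: sum_grid_fun.
move=> k; have [kC|kC] := boolP (C k).
  have := inC _ _ xS kC; have := inC _ _ zS kC.
  have := muP k _ xS; have := muP k _ zS; lia.
by have := outC _ _ xS kC; have := outC _ _ zS kC; lia.
Qed.

End Grid.

From mathcomp Require Import all_order all_algebra ring lra.
From mathcomp Require Import all_classical all_reals all_analysis.
Import Order.TTheory GRing.Theory Num.Theory.
Import numFieldNormedType.Exports.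

Local Open Scope classical_set_scope.
Local Open Scope ring_scope.

(** * Continuity and row vectors *)

Section Continuity.
Context {R : realType} {V : normedModType R} {T : topologicalType}.
Implicit Types (f g : T -> V) (s t : T -> R).

Lemma continuous_add f g :
  continuous f -> continuous g -> continuous (fun x => f x + g x).
Proof. by move=> cf cg x; exact: (continuousD (cf x) (cg x)). Qed.

Lemma continuous_sub f g :
  continuous f -> continuous g -> continuous (fun x => f x - g x).
Proof. by move=> cf cg x; exact: (continuousB (cf x) (cg x)). Qed.

Lemma continuous_scale s f :
  continuous s -> continuous f -> continuous (fun x => s x *: f x).
Proof. by move=> cs cf x; exact: (continuousZ (cs x) (cf x)). Qed.

Lemma continuous_mul s t :
  continuous s -> continuous t -> continuous (fun x => s x * t x).
Proof. by move=> cs ct x; exact: (continuousM (cs x) (ct x)). Qed.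

Lemma continuous_inv s :
  continuous s -> (forall x, s x != 0) -> continuous (fun x => (s x)^-1).
Proof. by move=> cs s0 x; exact: (continuousV (s0 x) (cs x)). Qed.

Lemma continuous_maxr s t :
  continuous s -> continuous t -> continuous (fun x => Num.max (s x) (t x)).
Proof. by move=> cs ct x; exact: (continuous_max (cs x) (ct x)). Qed.

Lemma continuous_sum (I : finType) (F : I -> T -> V) :
  (forall i, continuous (F i)) -> continuous (fun x => \sum_i F i x).
Proof.
by move=> cF; apply: continuous_big => [|i _]; [exact: add_continuous|exact: cF].
Qed.

Lemma continuous_prod (I : finType) (P : pred I) (F : I -> T -> R) :
  (forall i, continuous (F i)) -> continuous (fun x => \prod_(i | P i) F i x).
Proof.
by move=> cF; apply: continuous_big => [|i _]; [exact: mul_continuous|exact: cF].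
Qed.

End Continuity.

Section RowVectors.
Context {R : realType} {d : nat}.
Implicit Types (u v : 'rV[R]_d).

Lemma row_coord_norm v k : `|v 0 k| <= `|v|.
Proof.
have /mapP[j Hj ->] : `|v 0 k| \in [seq `|v x.1 x.2| | x : 'I_1 * 'I_d].
  by apply/mapP; exists (0, k) => //=; rewrite mem_enum.
by rewrite [leRHS]mx_normrE; apply/bigmax_geP; right => /=; exists j.
Qed.

Lemma row_norm_lt v (e : R) : 0 < e -> (forall k, `|v 0 k| < e) -> `|v| < e.
Proof.
move=> e0 ve; rewrite [ltLHS]mx_normrE; apply/bigmax_ltP; split => //.
by move=> [i k] _ /=; rewrite (ord1 i).
Qed.

End RowVectors.

(** * The fixed point theorem *)

Section Brouwer.
Context {R : realType} {d : nat}.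
Implicit Types (y : 'rV[R]_d) (i : option 'I_d).

(** Up to the factor d * 2, these are the barycentric coordinates of y in the
    simplex cut out by 1 + y_k >= 0 for all k and by the inequality that the
    sum of the y_k is at most d; this simplex contains the unit ball of the
    maximum norm. *)
Definition bary i y : R :=
  if i is Some k then 1 + y 0 k else \sum_k (1 - y 0 k).

Lemma sum_option (F : option 'I_d -> R) :
  \sum_i F i = F None + \sum_k F (Some k).
Proof.
rewrite (bigD1 None) //=; congr (_ + _).
rewrite (reindex_omap Some id); last by case.
by apply: eq_bigl => k; rewrite eqxx.
Qed.

Lemma sum_bary y : \sum_i bary i y = (d * 2)%:R.
Proof.
rewrite sum_option /= -big_split /= (eq_bigr (fun=> 2%:R)).
  by rewrite sumr_const card_ord -mulrnA mulnC.
by move=> k _; rewrite addrCA subrK -[2%:R](natrD _ 1 1) addrC.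
Qed.

Lemma bary_ge0 i y : `|y| <= 1 -> 0 <= bary i y.
Proof.
move=> y1; have yk k : -1 <= y 0 k <= 1.
  by rewrite -ler_norml (le_trans (row_coord_norm _ _)).
case: i => [k|] /=; first by have := yk k; lra.
by apply: sumr_ge0 => k _; have := yk k; lra.
Qed.

Lemma bary_continuous i : continuous (bary i).
Proof.
have cc k : continuous (fun y : 'rV[R]_d => y 0 k) by exact: coord_continuous.
have c1 : continuous (fun _ : 'rV[R]_d => 1 : R) by apply: cst_continuous.
case: i => [k|]; first exact: (@continuous_add _ R^o).
apply: (@continuous_sum _ R^o) => k; exact: (@continuous_sub _ R^o).
Qed.

(** The coordinates of y and of y' have the same sum. *)
Lemma bary_le_eq y y' : (forall i, bary i y <= bary i y') -> y = y'.
Proof.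
move=> le_yy'.
have le_k k : y 0 k <= y' 0 k by have := le_yy' (Some k); rewrite /= lerD2l.
have ge_sum : \sum_k (y' 0 k - y 0 k) <= 0.
  have := le_yy' None; rewrite /= -subr_ge0 -sumrB => le0.
  rewrite -oppr_ge0 -sumrN; apply: le_trans le0 _; apply: ler_sum => k _; lra.
have /allP eq0 : all (fun k => true ==> (y' 0 k - y 0 k == 0)) (index_enum 'I_d).
  rewrite -psumr_eq0; last by move=> k _; rewrite subr_ge0.
  by rewrite eq_le ge_sum sumr_ge0 // => k _; rewrite subr_ge0.
apply/rowP => k; apply/eqP; rewrite eq_sym -subr_eq0.
by have := eq0 k; rewrite mem_index_enum; apply.
Qed.

(** Color a lattice point by an index whose barycentric coordinate does not
    decrease under Phi. The cells given by scarf_grid shrink and accumulate at a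
    point where no coordinate decreases: for a coordinate that has a point of
    its own color nearby this passes to the limit, and a coordinate that tends
    to zero cannot decrease since Phi takes its values in the simplex. Such a
    point is fixed. The proof is by contradiction: a point that is not fixed has
    a neighborhood which the cells eventually avoid, and by compactness they
    would eventually avoid the whole box. *)
Theorem brouwer (Phi : 'rV[R]_d -> 'rV[R]_d) :
  continuous Phi -> (forall y, `|Phi y| <= 1) -> exists z, Phi z = z.
Proof.
move=> cPhi Phi1; apply: contrapT => noz.
pose D : R := (d * 2)%:R.
pose pt n (x : {ffun option 'I_d -> nat}) : 'rV[R]_d :=
  \row_k (D * (x (Some k))%:R / n.+1%:R - 1).
have baryE n (x : {ffun option 'I_d -> nat}) i :
    (\sum_i x i = n.+1)%N -> bary i (pt n x) = D * (x i)%:R / n.+1%:R.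
  move=> sx; case: i => [k|] /=; first by rewrite mxE addrC subrK.
  apply: (addIr (\sum_k bary (Some k) (pt n x))).
  rewrite -[LHS](sum_option (fun i => bary i (pt n x))) sum_bary.
  under eq_bigr do rewrite /= mxE addrC subrK.
  rewrite -mulr_suml -mulr_sumr -!(mulrA D) -mulrDr -mulrDl.
  rewrite -natr_sum -natrD.
  have -> : (x None + \sum_i x (Some i))%N = n.+1.
    rewrite -sx (bigD1 None) //=; congr (_ + _)%N.
    rewrite [RHS](reindex_omap Some id); last by case.
    by apply: eq_bigl => k; rewrite eqxx.
  by rewrite divff ?mulr1 // pnatr_eq0.
have ex_color y : exists i, bary i y <= bary i (Phi y).
  apply: contrapT => /forallNP nle.
  have : \sum_i bary i (Phi y) < \sum_i bary i y.
    apply: ltr_sum; first by apply/hasP; exists None; rewrite ?mem_index_enum.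
    by move=> i _; rewrite ltNge; apply/negP/nle.
  by rewrite !sum_bary ltxx.
pose color n x := sval (cid (ex_color (pt n x))).
have colorP n x : bary (color n x) (pt n x) <= bary (color n x) (Phi (pt n x)).
  by rewrite /color; case: cid.
pose K := #|{: option 'I_d}|.
(* Q n y: the lattice of level n + 1 has y as a point, and for each index i it
   has a point of color i at most K steps away, unless the i-th coordinate of y
   is itself at most K steps. *)
pose Q n y := exists2 z : {ffun option 'I_d -> nat}, (\sum_i z i = n.+1)%N &
  y = pt n z /\ forall i, (z i <= K)%N \/
    exists x : {ffun option 'I_d -> nat}, [/\ (\sum_k x k = n.+1)%N,
      color n x = i & forall k, (x k <= z k + K)%N /\ (z k <= x k + K)%N].
have exQ n : exists y, Q n y.
  have [z zn zP] := @scarf_grid (option 'I_d) n.+1 None (color n).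
  by exists (pt n z), z.
pose B := [set y : 'rV[R]_d | forall k, `[-1, D]%classic (y ord0 k)].
have Bcompact : compact B.
  by apply: (@rV_compact R d (fun=> `[-1, D]%classic)) => k; exact: segment_compact.
have QB n y : Q n y -> B y.
  move=> [z sz [-> _]] k /=; rewrite in_itv /= mxE.
  have n0 : 0 < n.+1%:R :> R by [].
  have zn : 0 <= ((z (Some k))%:R : R) / n.+1%:R <= 1.
    rewrite divr_ge0 //= ler_pdivrMr // mul1r ler_nat -sz.
    by rewrite (bigD1 (Some k)) //= leq_addr.
  have D0 : 0 <= D by rewrite ler0n.
  have /andP[t0 t1] := zn.
  rewrite -mulrA; have := mulr_ge0 D0 t0; have := ler_wpM2l D0 t1.
  rewrite mulr1; move: (D * (_ / _)) D0 => w *; apply/andP; split; lra.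
have /compact_near_coveringP/(_ nat \oo (fun n y => ~ Q n y)) := Bcompact.
move=> /(_ _) [].
  move=> y By.
  have [i lti] : exists i, bary i (Phi y) < bary i y.
    apply: contrapT => /forallNP nlt; apply: noz; exists y.
    apply/esym/bary_le_eq => i; rewrite leNgt; exact/negP/nlt.
  have bi_gt0 : 0 < bary i y by apply: le_lt_trans lti; apply: bary_ge0.
  have cg : continuous (fun y => bary i y - bary i (Phi y)).
    apply: (@continuous_sub _ R^o); first exact: bary_continuous.
    by move=> x; apply: continuous_comp; [exact: cPhi|exact: bary_continuous].
  have : \forall y' \near y, 0 < bary i y' - bary i (Phi y').
    by apply: (cvgr_gt _ (cg y)); rewrite subr_gt0.
  move=> /nbhs_ballP[rho /= rho0 Hrho].
  have rho2 : 0 < rho / 2 by rewrite divr_gt0.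
  have : \forall y' \near y, bary i y / 2 < bary i y'.
    by apply: (cvgr_gt _ (@bary_continuous i y)); rewrite gtr_pMr // invf_lt1 // ltr1n.
  move=> near1.
  have near2 : \forall n \near \oo, (D * K%:R) / n.+1%:R < Num.min (rho / 2) (bary i y / 2) :> R.
    have c0 : 0 < Num.min (rho / 2) (bary i y / 2) by rewrite lt_min rho2 divr_gt0.
    have DK : 0 < D * K%:R + 1.
      by rewrite ltr_wpDl // mulr_ge0.
    have e0 : 0 < Num.min (rho / 2) (bary i y / 2) / (D * K%:R + 1) by rewrite divr_gt0.
    near=> n.
    have : n.+1%:R^-1 < Num.min (rho / 2) (bary i y / 2) / (D * K%:R + 1).
      by near: n; exact: (near_infty_natSinv_lt (PosNum e0)).
    rewrite ltr_pdivlMr // mulrC => Hn; apply: le_lt_trans Hn.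
    by rewrite ler_wpM2r // lerDl.
  near=> y' n => /= -[z sz [y'E /(_ i)]].
  have [n1 n2] : (D * K%:R) / n.+1%:R < rho / 2 /\ (D * K%:R) / n.+1%:R < bary i y / 2.
    by apply/andP; rewrite -lt_min; near: n; exact: near2.
  have yy' : bary i y / 2 < bary i y' by near: y'; exact: near1.
  have yball : ball y (rho / 2) y' by near: y'; exact: nbhsx_ballx.
  case=> [zK|[x [sx cx xz]]].
    suff : bary i y' <= D * K%:R / n.+1%:R.
      by move=> /le_lt_trans/(_ n2)/lt_trans/(_ yy'); rewrite ltxx.
    rewrite y'E baryE // ler_wpM2r // ler_wpM2l ?ler_nat // ?ler0n.
  have : ball y rho (pt n x).
    rewrite [rho]splitr; apply: ball_triangle yball _.
    rewrite -ball_normE /= y'E; apply: row_norm_lt => // k.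
    apply: le_lt_trans n1.
    rewrite !mxE opprB addrA subrK -!mulrA -mulrBr -mulrBl !mulrA.
    rewrite normrM (@ger0_norm _ (n.+1%:R^-1)) // ler_wpM2r //.
    rewrite normrM (@ger0_norm _ D) ?ler0n // ler_wpM2l ?ler0n //.
    have [h1 h2] := xz (Some k).
    by rewrite ler_distl lerBlDr -!natrD !ler_nat h1 h2.
  move=> /Hrho; have := colorP n x; rewrite cx; lra.
move=> N _ /(_ N (leqnn N)) nQ.
by have [y Qy] := exQ N; exact: nQ (QB _ _ Qy) Qy.
Unshelve. all: by end_near. Qed.

End Brouwer.

(** * The Euclidean structure and outward fields on the sphere *)

Section DotProduct.
Context {R : realType} {d : nat}.
Implicit Types (u v w p : 'rV[R]_d) (a : R).

Lemma dotmulC u v : dotmul u v = dotmul v u.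
Proof. by apply: eq_bigr => k _; rewrite mulrC. Qed.

Lemma dotmulDr u v w : dotmul u (v + w) = dotmul u v + dotmul u w.
Proof. by rewrite -big_split; apply: eq_bigr => k _; rewrite mxE mulrDr. Qed.

Lemma dotmulZr a u v : dotmul u (a *: v) = a * dotmul u v.
Proof. by rewrite mulr_sumr; apply: eq_bigr => k _; rewrite mxE mulrCA. Qed.

Lemma dotmulZl a u v : dotmul (a *: u) v = a * dotmul u v.
Proof. by rewrite dotmulC dotmulZr dotmulC. Qed.

Lemma dotmulNr u v : dotmul u (- v) = - dotmul u v.
Proof. by rewrite -scaleN1r dotmulZr mulN1r. Qed.

Lemma dotmulBr u v w : dotmul u (v - w) = dotmul u v - dotmul u w.
Proof. by rewrite dotmulDr dotmulNr. Qed.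

Lemma dotmul0r u : dotmul u 0 = 0.
Proof. by rewrite -(scale0r u) dotmulZr mul0r. Qed.

Lemma dotmul_sumr (I : finType) u (F : I -> 'rV[R]_d) :
  dotmul u (\sum_i F i) = \sum_i dotmul u (F i).
Proof. exact: (big_morph _ (dotmulDr u) (dotmul0r u)). Qed.

Lemma dotmul_ge0 u : 0 <= dotmul u u.
Proof. by apply: sumr_ge0 => k _; rewrite -expr2 sqr_ge0. Qed.

Lemma enorm_ge0 u : 0 <= enorm u. Proof. exact: sqrtr_ge0. Qed.

Lemma enormE u : dotmul u u = enorm u ^+ 2.
Proof. by rewrite sqr_sqrtr ?dotmul_ge0. Qed.

Lemma enormZ a u : 0 <= a -> enorm (a *: u) = a * enorm u.
Proof.
move=> a0; rewrite /enorm dotmulZl dotmulZr mulrA -expr2 sqrtrM ?sqr_ge0 //.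
by rewrite sqrtr_sqr ger0_norm.
Qed.

Lemma norm_le_enorm u : `|u| <= enorm u.
Proof.
rewrite [leLHS]mx_normrE; apply/bigmax_leP; split => [|[i k] _ /=].
  exact: enorm_ge0.
rewrite (ord1 i) -sqrtr_sqr ler_sqrt ?dotmul_ge0 //.
rewrite /dotmul (bigD1 k) //= expr2 lerDl.
by apply: sumr_ge0 => j _; rewrite -expr2 sqr_ge0.
Qed.

Lemma enorm_gt0 u : u != 0 -> 0 < enorm u.
Proof. by move=> u0; apply: lt_le_trans (norm_le_enorm u); rewrite normr_gt0. Qed.

Lemma dotmul_continuous (T : topologicalType) (f g : T -> 'rV[R]_d) :
  continuous f -> continuous g -> continuous (fun x => dotmul (f x) (g x)).
Proof.
move=> cf cg; apply: (@continuous_sum _ R^o) => k.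
have cc (h : T -> 'rV[R]_d) : continuous h -> continuous (fun x => h x 0 k).
  move=> ch x; apply: (@continuous_comp _ _ _ h (fun v : 'rV[R]_d => v 0 k)).
    exact: ch.
  exact: coord_continuous.
by apply: continuous_mul; apply: cc.
Qed.

Lemma enorm_continuous (T : topologicalType) (f : T -> 'rV[R]_d) :
  continuous f -> continuous (fun x => enorm (f x)).
Proof.
move=> cf x; apply: (@continuous_comp _ _ _ (fun x => dotmul (f x) (f x))).
  exact: dotmul_continuous.
exact: sqrt_continuous.
Qed.

(** Let V be the vector field which is F (m / |m|) scaled by 2 |m| - 1, minus
    (1 - |m|) p, and which is a nonzero multiple of p where |m| <= 1/2. On the
    unit sphere V = F points outward, so V vanishes at some z in the open ball
    by Brouwer's theorem, applied to the projection of m - V m to the ball; as V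
    has no zero where |m| <= 1/2, the equation V z = 0 puts F (z / |z|) on the
    ray of p. *)
Lemma sphere_hits_ray (F : 'rV[R]_d -> 'rV[R]_d) p :
  continuous F -> p != 0 ->
  (forall u, enorm u = 1 -> 0 < dotmul u (F u)) ->
  exists u s, [/\ enorm u = 1, 0 < s & F u = s *: p].
Proof.
move=> cF p0 Fout.
(* The maximum with 1/2 only serves to keep V continuous at the origin. *)
pose E (m : 'rV[R]_d) : R := Num.max (enorm m) 2^-1.
pose V (m : 'rV[R]_d) := Num.max 0 (2 * enorm m - 1) *: F ((E m)^-1 *: m) - (1 - enorm m) *: p.
pose M (m : 'rV[R]_d) : R := Num.max 1 (enorm (m - V m)).
have cid : continuous (fun m : 'rV[R]_d => m) by move=> m; exact: cvg_id.
have cst (r : R) : continuous (fun _ : 'rV[R]_d => r) by apply: cst_continuous.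
have cN : continuous (fun m : 'rV[R]_d => enorm m) by exact: enorm_continuous.
have cV : continuous V.
  apply: continuous_sub; apply: continuous_scale.
  - apply: continuous_maxr => //; apply: (@continuous_sub _ R^o) => //.
    exact: continuous_mul.
  - move=> m; apply: continuous_comp; last exact: cF.
    move: m; apply: continuous_scale => //; apply: continuous_inv => [|m].
      exact: continuous_maxr.
    by rewrite gt_eqF // lt_max orbC invr_gt0 ltr0n.
  - exact: (@continuous_sub _ R^o).
  - exact: cst_continuous.
have M1 m : 1 <= M m by rewrite le_max lexx.
have M0 m : 0 < M m by apply: lt_le_trans (M1 m).
have P1 m : enorm ((M m)^-1 *: (m - V m)) <= 1.
  have M_ge0 : 0 <= (M m)^-1 by rewrite invr_ge0 ltW.
  by rewrite enormZ // ler_pdivrMl // mulr1 le_max lexx orbT.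
have [||z zE] := @brouwer R d (fun m => (M m)^-1 *: (m - V m)).
- apply: continuous_scale; last exact: continuous_sub.
  apply: continuous_inv => [|m]; last by rewrite gt_eqF.
  by apply: continuous_maxr => //; apply: enorm_continuous; apply: continuous_sub.
- by move=> m; exact: le_trans (norm_le_enorm _) (P1 m).
have VE : V z = (1 - M z) *: z.
  have := congr1 (fun y => M z *: y) zE.
  rewrite /= scalerA mulfV ?gt_eqF // scale1r scalerBl scale1r => <-.
  by rewrite subKr.
have z1 : enorm z <= 1 by rewrite -zE.
have {z1}z1 : enorm z < 1.
  rewrite lt_neqAle z1 andbT; apply/eqP => zz.
  have Vz : V z = F z.
    rewrite /V /E zz subrr scale0r subr0 mulr1.
    rewrite (@max_r _ _ 0); last by rewrite subr_ge0 ler1n.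
    rewrite max_l; last by rewrite invf_le1 ?ler1n.
    by rewrite invr1 scale1r (_ : 2 - 1 = 1) ?scale1r //; ring.
  have := Fout z zz; rewrite -Vz VE dotmulZr enormE zz expr1n mulr1.
  by rewrite subr_gt0 ltNge M1.
(* Otherwise the radial projection would put z on the unit sphere. *)
have MZ : M z = 1.
  apply/eqP; rewrite /M eq_le le_max lexx /= andbT ge_max lexx /=.
  rewrite leNgt; apply/negP => w1; have := z1.
  rewrite -zE enormZ ?invr_ge0 ?ltW // /M max_r ?ltW // mulVf ?ltxx //.
  by rewrite gt_eqF // (lt_trans _ w1).
move: VE; rewrite MZ subrr scale0r /V => /eqP; rewrite subr_eq0 => /eqP VE.
have b0 : 0 < 1 - enorm z by rewrite subr_gt0.
have z2 : 0 < 2 * enorm z - 1.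
  rewrite ltNge; apply/negP => le0; move: VE.
  rewrite max_l // scale0r => /esym/eqP; rewrite scaler_eq0 (negPf p0) orbF.
  by rewrite gt_eqF.
have zE2 : E z = enorm z.
  by rewrite /E max_l // -[leLHS]mul1r ler_pdivrMr //; lra.
have z0 : 0 < enorm z by lra.
exists ((enorm z)^-1 *: z), ((2 * enorm z - 1)^-1 * (1 - enorm z)); split.
- by rewrite enormZ ?invr_ge0 ?ltW // mulVf ?gt_eqF.
- by rewrite mulr_gt0 ?invr_gt0.
- rewrite -scalerA -VE max_r ?ltW // scalerA mulVf ?gt_eqF // scale1r.
  by rewrite zE2.
Qed.

End DotProduct.

(** * The weights and their uniform estimate *)

Lemma finite_bound (R : realType) (I : finType) (F : I -> R) :
  exists2 M, 1 <= M & forall i, F i <= M.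
Proof.
exists (1 + \sum_i `|F i|); first by rewrite lerDl sumr_ge0.
move=> i; rewrite (bigD1 i) //= addrCA.
apply: le_trans (ler_norm _) _; rewrite lerDl addr_ge0 //.
exact: sumr_ge0.
Qed.

Section Weights.
Context {R : realType} {n d : nat} (x : 'I_n -> 'rV[R]_d).
Implicit Types (e : R) (u : 'rV[R]_d) (i j p : 'I_n).

Lemma c_pair_gt0 e u i j : 0 < e -> 0 < c_pair x e u i j.
Proof. by move=> e0; rewrite ltr_pwDl // le_max lexx. Qed.

Lemma c_point_gt0 e u i : 0 < e -> 0 < c_point x e u i.
Proof. by move=> e0; apply: prodr_gt0 => j _; apply: c_pair_gt0. Qed.

Hypothesis n_gt0 : (0 < n)%N.

Lemma sum_c_point_gt0 e u : 0 < e -> 0 < \sum_j c_point x e u j.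
Proof.
move=> e0; rewrite (bigD1 (Ordinal n_gt0)) //=.
rewrite ltr_pwDl ?c_point_gt0 // sumr_ge0 // => j _.
exact/ltW/c_point_gt0.
Qed.

Lemma lambda_weight_gt0 e u i : 0 < e -> 0 < lambda_weight x e u i.
Proof. by move=> e0; rewrite divr_gt0 ?c_point_gt0 ?sum_c_point_gt0. Qed.

Lemma sum_lambda_weight e u : 0 < e -> \sum_i lambda_weight x e u i = 1.
Proof. by move=> e0; rewrite -mulr_suml divff // gt_eqF ?sum_c_point_gt0. Qed.

Lemma f_eps_continuous e : 0 < e -> continuous (f_eps x e).
Proof.
move=> e0.
have cc i : continuous (fun u => c_point x e u i).
  apply: continuous_prod => j; apply: (@continuous_add _ R^o).
    by apply: cst_continuous.
  apply: continuous_maxr; first by apply: cst_continuous.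
  have cN : continuous (fun u => 0 - dotmul u (unit_dir x i j)).
    apply: (@continuous_sub _ R^o); first by apply: cst_continuous.
    apply: dotmul_continuous; last by apply: cst_continuous.
    by move=> u; exact: cvg_id.
  by move: cN; under eq_fun do rewrite sub0r.
apply: continuous_sum => i; apply: continuous_scale; last by apply: cst_continuous.
apply: continuous_mul => //; apply: continuous_inv; last first.
  by move=> u; rewrite gt_eqF // sum_c_point_gt0.
exact: (@continuous_sum _ R^o).
Qed.

(** The weights have sum 1. *)
Lemma dotmul_gap (e : R) u v : 0 < e ->
  dotmul u v - dotmul u (f_eps x e u) =
  \sum_i lambda_weight x e u i * (dotmul u v - dotmul u (x i)).
Proof.
move=> e0; rewrite dotmul_sumr.
under [in RHS]eq_bigr do rewrite mulrBr.
rewrite sumrB -mulr_suml sum_lambda_weight // mul1r.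
by congr (_ - _); apply: eq_bigr => i _; rewrite dotmulZr.
Qed.

Lemma c_pairE e u i j :
  c_pair x e u i j = e + Num.max 0 ((enorm (x j - x i))^-1 * (dotmul u (x i) - dotmul u (x j))).
Proof. by rewrite /c_pair dotmulZr dotmulBr -mulrN opprB. Qed.

Hypothesis x_inj : injective x.

(** Let p maximize the scalar product of u with the points, and let t be the gap
    between the values at p and at k. In c_point x e u k the factor of the pair
    (k, p) is e, while in c_point x e u p the factor of (p, k) is at least
    t / D. Each remaining factor of the former is at most M times the
    corresponding factor of the latter. So the weight of k times its gap is
    at most a constant times e. *)
Lemma support_gap : exists2 C, 0 < C &
  forall e u i, 0 < e -> dotmul u (x i) - dotmul u (f_eps x e u) <= C * e.
Proof.
pose r i j := enorm (x j - x i).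
have r_gt0 i j : i != j -> 0 < r i j.
  by move=> ij; rewrite enorm_gt0 // subr_eq0 (inj_eq x_inj) eq_sym.
have [D D1 rD] := finite_bound (fun ij : 'I_n * 'I_n => r ij.1 ij.2).
have [M M1 rM] := finite_bound
  (fun t : 'I_n * 'I_n * 'I_n => r t.1.1 t.2 / r t.1.2 t.2).
have D0 : 0 < D by lra.
have M0 : 0 < M by lra.
have MnD : 0 < M ^+ n * D by rewrite mulr_gt0 ?exprn_gt0.
exists (n%:R * (M ^+ n * D)); first by rewrite mulr_gt0 // ltr0n.
move=> e u i e0.
pose p := [arg max_(k > Ordinal n_gt0) dotmul u (x k)]%O.
have pmax k : dotmul u (x k) <= dotmul u (x p).
  by rewrite /p; case: arg_maxP => // q _; apply.
apply: (@le_trans _ _ (dotmul u (x p) - dotmul u (f_eps x e u))).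
  by rewrite lerD2r.
rewrite dotmul_gap //.
have Sc := sum_c_point_gt0 u e0.
suff Hk k : lambda_weight x e u k * (dotmul u (x p) - dotmul u (x k)) <= M ^+ n * D * e.
  apply: le_trans (ler_sum _ (fun k _ => Hk k)) _.
  by rewrite sumr_const card_ord -[leLHS]mulr_natl !mulrA.
rewrite /lambda_weight mulrAC ler_pdivrMr //.
apply: (@le_trans _ _ (M ^+ n * D * e * c_point x e u p)); last first.
  rewrite ler_pM2l; last exact: mulr_gt0.
  rewrite (bigD1 p) //= lerDl.
  by apply: sumr_ge0 => j _; apply/ltW/c_point_gt0.
set t := _ - _; have t0 : 0 <= t by rewrite subr_ge0.
have [kp|kp] := eqVneq k p.
  by rewrite /t kp subrr mulr0 ltW // mulr_gt0 ?c_point_gt0 // mulr_gt0.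
have pk : p != k by rewrite eq_sym.
rewrite /c_point (bigD1 p) //= [in leRHS](bigD1 k) //=.
have -> : c_pair x e u k p = e.
  rewrite c_pairE max_l ?addr0 // mulr_ge0_le0 ?invr_ge0 ?enorm_ge0 //.
  by rewrite subr_le0.
have ctp : t <= D * c_pair x e u p k.
  have r0 := r_gt0 p k pk.
  have rt : 0 <= (r p k)^-1 * t by rewrite mulr_ge0 // invr_ge0 ltW.
  rewrite c_pairE -/t max_r // -[leLHS](mulVKf (lt0r_neq0 r0)).
  apply: ler_pM => //; first exact: ltW.
    exact: (rD (p, k)).
  by rewrite lerDr ltW.
set P1 := \prod_(_ | _) _; set P2 := \prod_(_ | _) _.
have P2_ge0 : 0 <= P2 by apply: prodr_ge0 => j _; apply/ltW/c_pair_gt0.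
have PP : P1 <= M ^+ n * P2.
  apply: (@le_trans _ _ (\prod_(j | (j != k) && (j != p)) (M * c_pair x e u p j))).
    apply: ler_prod => j /andP[jk jp]; rewrite ltW ?c_pair_gt0 //=.
    have := rM (p, k, j); rewrite /= ler_pdivrMr ?r_gt0 1?eq_sym // => rMj.
    have h0 : 0 <= dotmul u (x p) - dotmul u (x j) by rewrite subr_ge0.
    rewrite !c_pairE [M * _]mulrDr lerD //; first by rewrite ler_peMl // ltW.
    rewrite (@max_r _ _ 0 (_^-1 * (dotmul u (x p) - _))); last first.
      by rewrite mulr_ge0 // invr_ge0 enorm_ge0.
    rewrite ge_max; apply/andP; split.
      by rewrite mulr_ge0 ?(ltW M0) // mulr_ge0 // invr_ge0 enorm_ge0.
    apply: (@le_trans _ _ ((r k j)^-1 * (dotmul u (x p) - dotmul u (x j)))).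
      by rewrite ler_wpM2l ?invr_ge0 ?enorm_ge0 // lerD2r.
    rewrite mulrA ler_wpM2r //.
    rewrite -/(r p j) ler_pdivlMr ?r_gt0 1?eq_sym // mulrC ler_pdivrMr ?r_gt0 1?eq_sym //.
  rewrite big_split /= prodr_const.
  have -> : \prod_(j | (j != k) && (j != p)) c_pair x e u p j = P2.
    by apply: eq_bigl => j; rewrite andbC.
  rewrite ler_wpM2r // ler_weXn2l //.
  by rewrite -[leqRHS]card_ord max_card.
rewrite -[leLHS]mulrA [leRHS](_ : _ = e * ((M ^+ n * P2) * (D * c_pair x e u p k))); last by ring.
rewrite ler_wpM2l ?(ltW e0) // ler_pM //.
by apply: prodr_ge0 => j _; apply/ltW/c_pair_gt0.
Qed.

End Weights.

(** * Convex hulls *)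

Lemma closure_sub_closed (T : topologicalType) (A B : set T) :
  A `<=` B -> closed B -> closure A `<=` B.
Proof. by move=> AB /closure_id ->; exact: closure_subset. Qed.

Section ConvexHull.
Context {R : realType} {d : nat}.
Implicit Types (u v y z : 'rV[R]_d) (A : set 'rV[R]_d).

Lemma convex_setP A :
  @convex_set R 'rV[R]_d A <->
  forall y z (t : R), 0 <= t <= 1 -> A y -> A z -> A (t *: y + (1 - t) *: z).
Proof.
split=> [cA y z t /andP[t0 t1] Ay Az|cA y z t].
  by apply/set_mem; apply: (cA y z (Itv01 t0 t1)); apply/mem_set.
move=> /set_mem Ay /set_mem Az; apply/mem_set; apply: cA => //.
by rewrite ge0 le1.
Qed.

Lemma convex_hull_convex A : @convex_set R 'rV[R]_d (convex_hull A).
Proof.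
apply/convex_setP => y z t t01 Ay Az B [/[dup] + cB AB].
by move=> /convex_setP; apply => //; [apply: Ay|apply: Az].
Qed.

Lemma sub_convex_hull A : A `<=` convex_hull A.
Proof. by move=> y Ay B [_]; apply. Qed.

(** Adding the points one at a time, with the partial sums normalized to total
    weight 1. *)
Lemma convex_sum (I : finType) (B : set 'rV[R]_d) (a : I -> R) (y : I -> 'rV[R]_d) :
  @convex_set R 'rV[R]_d B -> (forall i, B (y i)) ->
  (forall i, 0 <= a i) -> \sum_i a i = 1 -> B (\sum_i a i *: y i).
Proof.
move=> /convex_setP cB By a0 a1.
suff H (r : seq I) : 0 < \sum_(i <- r) a i ->
    B ((\sum_(i <- r) a i)^-1 *: \sum_(i <- r) a i *: y i).
  by have := H (index_enum I); rewrite a1 invr1 scale1r; apply.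
elim: r => [|i r IH]; first by rewrite big_nil ltxx.
rewrite !big_cons; set S := \sum_(j <- r) a j; set Y := \sum_(j <- r) _.
move=> s0; have : 0 <= S by apply: sumr_ge0.
rewrite le_eqVlt => /orP[/eqP S0|S0].
  have Y0 : Y = 0.
    rewrite /Y big_seq big1 // => j jr.
    suff -> : a j = 0 by rewrite scale0r.
    apply/eqP; rewrite eq_le a0 andbT [leRHS]S0 /S.
    by rewrite (big_rem j jr) /= lerDl sumr_ge0.
  rewrite Y0 -S0 !addr0 scalerA mulVf ?scale1r //.
  by move: s0; rewrite -S0 addr0 => /lt0r_neq0.
have -> : (a i + S)^-1 *: (a i *: y i + Y) =
   (a i / (a i + S)) *: y i + (1 - a i / (a i + S)) *: (S^-1 *: Y).
  rewrite scalerDr !scalerA; congr (_ *: _ + _ *: _); first exact: mulrC.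
  by field; rewrite !gt_eqF.
apply: cB => //; last exact: IH.
by rewrite divr_ge0 ?(ltW s0) //= ler_pdivrMr // mul1r lerDl ltW.
Qed.

Lemma convex_hull_dotmul_le A u (h : R) :
  (forall y, A y -> dotmul u y <= h) -> forall y, convex_hull A y -> dotmul u y <= h.
Proof.
move=> Ah; suff : convex_hull A `<=` [set y | dotmul u y <= h] by [].
apply: smallest_sub => //; apply/convex_setP => y z t /andP[t0 t1] /= yh zh.
rewrite dotmulDr !dotmulZr.
have : t * (dotmul u y - h) <= 0 by rewrite mulr_ge0_le0 // subr_le0.
have : (1 - t) * (dotmul u z - h) <= 0 by rewrite mulr_ge0_le0 ?subr_le0 ?subr_ge0.
by rewrite -subr_ge0 -(subr_ge0 (_ * _)) -(subr_ge0 (_ + _)) => h1 h2; lra.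
Qed.

Lemma convex_hull_norm_le A (M : R) :
  (forall y, A y -> `|y| <= M) -> forall y, convex_hull A y -> `|y| <= M.
Proof.
move=> AM; suff : convex_hull A `<=` [set y | `|y| <= M] by [].
apply: smallest_sub => //; apply/convex_setP => y z t /andP[t0 t1] /= yM zM.
apply: le_trans (ler_normD _ _) _; rewrite !normrZ !ger0_norm ?subr_ge0 //.
have : t * `|y| <= t * M by rewrite ler_wpM2l.
have : (1 - t) * `|z| <= (1 - t) * M by rewrite ler_wpM2l ?subr_ge0.
by lra.
Qed.

Lemma closed_half_space u (h : R) : closed [set y : 'rV[R]_d | dotmul u y <= h].
Proof.
have cu : continuous (fun y : 'rV[R]_d => dotmul u y).
  apply: (@dotmul_continuous _ _ _ (fun=> u) id) => [|z]; last exact: cvg_id.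
  by apply: cst_continuous.
exact: (closed_comp (fun z _ => cu z) (@closed_le _ h)).
Qed.

(** The homothety of center f and ratio t maps a ball around o in A to a ball
    around t o + (1 - t) f. *)
Lemma convex_interior_segment (A : set 'rV[R]_d) o f (t : R) :
  @convex_set R 'rV[R]_d A -> A° o -> A f -> 0 < t <= 1 ->
  A° (t *: o + (1 - t) *: f).
Proof.
move=> /convex_setP cA /nbhs_ballP[r /= r0 oA] Af /andP[t0 t1].
apply/nbhs_ballP; exists (t * r) => /=; first exact: mulr_gt0.
move=> w; rewrite -ball_normE /= => bw.
have -> : w = t *: (o + t^-1 *: (w - (t *: o + (1 - t) *: f))) + (1 - t) *: f.
  by rewrite scalerDr scalerA mulfV ?gt_eqF // scale1r addrAC addrC subrK.
apply: cA => //; first by rewrite (ltW t0).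
apply: oA; rewrite -ball_normE /= opprD addrA subrr sub0r normrN normrZ.
by rewrite distrC gtr0_norm ?invr_gt0 // ltr_pdivrMl.
Qed.

End ConvexHull.

(** * The images of the sphere and the boundary of the hull *)

Section Nondegenerate.
Context {R : realType} {n d : nat} (x : 'I_n -> 'rV[R]_d).
Hypothesis n_gt0 : (0 < n)%N.
Hypothesis x_nondegenerate : nondegenerate_config x.
Let K := convex_hull (range x).
Let i0 := Ordinal n_gt0.

Lemma affine_hull_setT : affine_hull K = setT.
Proof.
apply/seteqP; split => // y _ A [affA KA].
have [->//|AT] := eqVneq A setT.
case: (x_nondegenerate affA AT); apply: subset_trans KA; exact: sub_convex_hull.
Qed.

(** Otherwise the points would lie in a proper affine subspace through x i0. *)
Lemma edges_span (v : 'rV[R]_d) : v \in <<[tuple x i - x i0 | i < n]>>%VS.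
Proof.
set V := <<_>>%VS; suff AT : affine_of (x i0) V = setT.
  have : affine_of (x i0) V (v + x i0) by rewrite AT.
  by rewrite /affine_of /= addrK.
apply: contrapT => /eqP AT.
apply: (x_nondegenerate _ AT); first by exists (x i0), V.
move=> _ [i _ <-] /=; apply: memv_span.
by apply/mapP; exists i; rewrite ?mem_enum // val_ord_tuple mem_enum.
Qed.

Lemma edge_coordinates : exists2 C : R, 0 < C & forall v : 'rV[R]_d,
  exists2 b : 'I_n -> R, v = \sum_i b i *: (x i - x i0) & forall i, `|b i| <= C * `|v|.
Proof.
pose X := [tuple x i - x i0 | i < n].
have [M M1 HM] := finite_bound (fun ik : 'I_n * 'I_d => `|coord X ik.1 (delta_mx 0 ik.2)|).
exists (d%:R * M + 1); first by rewrite ltr_wpDl // mulr_ge0 //; lra.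
move=> v; exists (fun i => coord X i v).
  rewrite {1}(coord_span (edges_span v)); apply: eq_bigr => i _.
  by rewrite -tnth_nth tnth_mktuple.
move=> i; rewrite {1}(row_sum_delta v) linear_sum /=.
apply: le_trans (ler_norm_sum _ _ _) _.
apply: (@le_trans _ _ (\sum_(k < d) M * `|v|)).
  apply: ler_sum => k _; rewrite linearZ /= normrM mulrC.
  by apply: ler_pM => //; [exact: (HM (i, k))|exact: row_coord_norm].
rewrite sumr_const card_ord -[leLHS]mulr_natl mulrA.
by rewrite ler_wpM2r // lerDl.
Qed.

(** A small vector is a combination of the edges x i - x i0 with small
    coefficients; adding them to the weights, and correcting the weight of i0 to
    keep the sum 1, leaves the weights nonnegative. *)
Lemma hull_perturb : exists2 L : R, 0 < L & forall (a : 'I_n -> R) (delta : R) v,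
  (forall i, delta <= a i) -> \sum_i a i = 1 -> `|v| <= L * delta ->
  K (\sum_i a i *: x i + v).
Proof.
have [C C0 HC] := edge_coordinates.
have n1 : 0 < n.+1%:R :> R by [].
exists (n.+1%:R * C)^-1; first by rewrite invr_gt0 mulr_gt0.
move=> a delta v ad a1 vd; have [b vb bC] := HC v.
pose B := \sum_i b i.
pose a' i := a i + (b i - if i == i0 then B else 0).
have -> : \sum_i a i *: x i + v = \sum_i a' i *: x i.
  under [RHS]eq_bigr do rewrite scalerDl scalerBl.
  rewrite big_split /= sumrB; congr (_ + _); rewrite vb.
  under eq_bigr do rewrite scalerBr.
  rewrite sumrB; congr (_ - _); rewrite -scaler_suml.
  rewrite -/B [RHS](bigD1 i0) // eqxx /= big1 ?addr0 // => i /negPf ->.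
  by rewrite scale0r.
apply: convex_sum.
- exact: convex_hull_convex.
- by move=> i; apply: sub_convex_hull; exists i.
- move=> i; rewrite /a'.
  have H : `|b i| + `|if i == i0 then B else 0| <= n.+1%:R * (C * `|v|).
    rewrite -addn1 natrD mulrDl mul1r addrC lerD //.
    have S_ge0 : \sum_(j < n) `|b j| <= n%:R * (C * `|v|).
      apply: le_trans (ler_sum _ (fun j _ => bC j)) _.
      by rewrite sumr_const card_ord mulr_natl.
    case: eqP => _; last by rewrite normr0 (le_trans _ S_ge0) // sumr_ge0.
    exact: le_trans (ler_norm_sum _ _ _) S_ge0.
  have H2 : n.+1%:R * (C * `|v|) <= delta.
    by rewrite mulrA -ler_pdivlMl ?mulr_gt0.
  have := ad i; have := le_trans H H2; have := ler_norm (- b i).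
  have := ler_norm (if i == i0 then B else 0).
  by rewrite normrN; move: (if _ then _ else _) => w; lra.
- rewrite big_split /= sumrB a1 -/B.
  rewrite (bigD1 i0 (F := fun i => if i == i0 then B else 0)) // eqxx /=.
  by rewrite big1 ?addr0 ?subrr ?addr0 // => i /negPf ->.
Qed.

Lemma interior_sum_gt0 (a : 'I_n -> R) :
  (forall i, 0 < a i) -> \sum_i a i = 1 -> K° (\sum_i a i *: x i).
Proof.
move=> a0 a1; have [L L0 HL] := hull_perturb.
have [M M1 HM] := finite_bound (fun i => (a i)^-1).
have M0 : 0 < M by lra.
apply/nbhs_ballP; exists (L * M^-1) => /=; first by rewrite mulr_gt0 ?invr_gt0.
move=> y; rewrite -ball_normE /= => /ltW; rewrite distrC => yL.
rewrite -(subrK (\sum_i a i *: x i) y) addrC.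
apply: (HL a M^-1) => // i.
by rewrite -[leRHS]invrK lef_pV2 ?posrE ?invr_gt0.
Qed.

Lemma f_eps_interior e u : 0 < e -> K° (f_eps x e u).
Proof.
move=> e0; apply: interior_sum_gt0 => [i|]; first exact: lambda_weight_gt0.
exact: sum_lambda_weight.
Qed.

Hypothesis x_inj : injective x.

(** A linear function is maximized over the hull, and over its closure, at one of
    the points. *)
Lemma hull_gap : exists2 C, 0 < C & forall e u y, 0 < e -> closure K y ->
  dotmul u y - dotmul u (f_eps x e u) <= C * e.
Proof.
have [C C0 HC] := support_gap n_gt0 x_inj; exists C => // e u y e0.
rewrite lerBlDr.
apply: (closure_sub_closed _ (@closed_half_space R d u (C * e + dotmul u (f_eps x e u)))).
apply: convex_hull_dotmul_le => _ [i _ <-].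
by rewrite -lerBlDr HC.
Qed.

(** In the direction u the hull reaches at least r / 2 beyond the center y. Hence,
    for small e, the point f_eps x e u differs from the center of any ball of a
    given radius inside the hull. *)
Lemma ball_gap : exists2 C, 0 < C & forall e u y (r : R), 0 < e ->
  enorm u = 1 -> 0 < r -> ball y r `<=` K ->
  dotmul u y + r / 2 - dotmul u (f_eps x e u) <= C * e.
Proof.
have [C C0 HC] := hull_gap; exists C => // e u y r e0 u1 r0 yK.
have : closure K (y + (r / 2) *: u).
  apply: subset_closure; apply: yK; rewrite -ball_normE /= opprD addrA subrr sub0r normrN.
  rewrite normrZ ger0_norm ?divr_ge0 ?(ltW r0) //.
  apply: (@le_lt_trans _ _ (r / 2)); last by lra.
  by rewrite -[leRHS]mulr1 ler_wpM2l ?divr_ge0 ?(ltW r0) // -u1 norm_le_enorm.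
by move=> /(HC e u _ e0); rewrite dotmulDr dotmulZr enormE u1 expr1n mulr1.
Qed.

Lemma hull_bounded : exists M : R, forall y, K y -> `|y| <= M.
Proof.
have [M _ HM] := finite_bound (fun i => `|x i|); exists M.
by apply: convex_hull_norm_le => _ [i _ <-].
Qed.

(** The part of closure K outside the interior of W is compact and lies in the
    interior of K, so its points are centers of balls inside K with radii
    bounded below; by ball_gap these points are not values of f_eps x e for
    small e. *)
Lemma f_eps_near_boundary W : set_nbhs (boundary K) W ->
  exists2 e0 : R, 0 < e0 & forall e, 0 < e < e0 -> f_eps x e @` unit_sphere `<=` W.
Proof.
move=> WK; pose A := closure K `\` W°.
have Acompact : compact A.
  apply: bounded_closed_compact.
    have [M HM] := hull_bounded; exists M; split; first exact: num_real.
    move=> M' MM' y [Ky _] /=; apply: le_trans (ltW MM').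
    apply: (closure_sub_closed HM _ Ky).
    exact: (closed_comp (fun z _ => @norm_continuous _ _ z) (@closed_le _ M)).
  rewrite /A setDE; apply: closedI; first exact: closed_closure.
  exact/open_closedC/open_interior.
have AK y : A y -> K° y.
  move=> [cKy nWy]; apply: contrapT => nKy; apply: nWy.
  exact: WK.
have [C C0 HC] := ball_gap.
have /compact_near_coveringP/(_ R 0^'+
  (fun e y => forall u, enorm u = 1 -> f_eps x e u <> y)) := Acompact.
move=> /(_ _)[].
  move=> y /AK /nbhs_ballP[r /= r0 yK].
  have r2 : 0 < r / 2 by rewrite divr_gt0.
  near=> y' e => u u1 fy.
  have e0 : 0 < e by near: e; exact: nbhs_right_gt.
  have yy' : ball y (r / 2) y' by near: y'; exact: nbhsx_ballx.
  have y'K : ball y' (r / 2) `<=` K.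
    by move=> w y'w; apply: yK; rewrite [r]splitr; apply: ball_triangle y'w.
  have := HC e u y' _ e0 u1 r2 y'K; rewrite fy addrAC subrr add0r leNgt => /negP; apply.
  rewrite mulrC -ltr_pdivlMr //; near: e; apply: nbhs_right_lt.
  by rewrite !divr_gt0.
move=> e0 /= e0_gt0 He; exists e0 => // e /andP[e_gt0 lt_e] _ [u u1 <-].
apply: contrapT => nW.
have := He e; rewrite /ball_ /= sub0r normrN ger0_norm ?(ltW e_gt0) // => /(_ lt_e e_gt0).
move=> /(_ (f_eps x e u)) H; apply: (H _ u u1 erefl); split.
  by apply: subset_closure; exact: interior_subset (f_eps_interior u e_gt0).
by move/interior_subset.
Unshelve. all: by end_near. Qed.

(** Seen from the barycenter o, the values of f_eps x e on the sphere point
    outward, so some value f_eps x e u lies on the ray from o through b, at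
    o + s (b - o). There s <= 1, as b is not interior. In the direction u the
    hull exceeds the value at o by r / 2 and reaches the value at b, hence it
    exceeds the value at f_eps x e u by (1 - s) r / 2, which must be at most a
    constant times e. So s tends to 1 linearly in e. *)
Lemma f_eps_close b : boundary K b -> exists D e0, [/\ 0 < D, 0 < e0,
  exists u : 'rV[R]_d, enorm u = 1 &
  forall e, 0 < e < e0 -> exists2 u, enorm u = 1 & `|b - f_eps x e u| <= D * e].
Proof.
move=> [bK nbK].
have n0 : 0 < n%:R :> R by rewrite ltr0n.
pose o := \sum_(i < n) n%:R^-1 *: x i.
have oK : K° o.
  apply: interior_sum_gt0 => [i|]; first by rewrite invr_gt0.
  by rewrite sumr_const card_ord -[LHS]mulr_natl mulfV // gt_eqF.
have bo : b - o != 0 by apply/eqP => /subr0_eq bo; apply: nbK; rewrite bo.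
have /nbhs_ballP[r /= r0 orK] := oK.
have [C1 C10 HC1] := ball_gap; have [C2 C20 HC2] := hull_gap.
exists (2 * (C1 + C2) / r * `|b - o|), (r / 2 / C1); split.
- by rewrite mulr_gt0 ?normr_gt0 // divr_gt0 // mulr_gt0 // addr_gt0.
- by rewrite !divr_gt0.
- exists ((enorm (b - o))^-1 *: (b - o)).
  by rewrite enormZ ?invr_ge0 ?enorm_ge0 // mulVf // gt_eqF // enorm_gt0.
move=> e /andP[e0]; rewrite ltr_pdivlMr // mulrC => eC.
have [||u [s [u1 s0 fE]]] := @sphere_hits_ray R d (fun u => f_eps x e u - o) _ _ bo.
- apply: continuous_sub; first exact: f_eps_continuous.
  by apply: cst_continuous.
- move=> u u1; rewrite dotmulBr; have := HC1 e u o r e0 u1 r0 orK.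
  move: (dotmul _ _) (dotmul _ _) => p q; lra.
exists u => //.
have s1 : s <= 1.
  rewrite leNgt; apply/negP => s1; apply: nbK.
  have -> : b = (1 - s^-1) *: o + (1 - (1 - s^-1)) *: f_eps x e u.
    rewrite subKr -(subrK o (f_eps x e u)) fE scalerDr scalerA mulVf ?gt_eqF //.
    by rewrite scale1r scalerBl scale1r [_ + s^-1 *: o]addrC addrA subrK addrC subrK.
  apply: convex_interior_segment => //.
  - exact: convex_hull_convex.
  - exact: interior_subset (f_eps_interior u e0).
  - rewrite subr_gt0 invf_lt1 // s1 /= lerBlDr lerDl invr_ge0.
    exact: ltW.
have fE' : f_eps x e u = (1 - s) *: o + s *: b.
  by rewrite -(subrK o (f_eps x e u)) fE scalerBr scalerBl scale1r addrC addrAC addrA.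
have gap : (1 - s) * (r / 2) <= (C1 + C2) * e.
  have := HC1 e u o r e0 u1 r0 orK; have := HC2 e u b e0 bK.
  have : dotmul u (f_eps x e u) = (1 - s) * dotmul u o + s * dotmul u b.
    by rewrite fE' dotmulDr !dotmulZr.
  move: (dotmul u (f_eps x e u)) (dotmul u o) (dotmul u b) => F O B FE h2 h1.
  have := ler_wpM2l (_ : 0 <= 1 - s) h1; rewrite subr_ge0 => /(_ s1).
  have := ler_wpM2l (ltW s0) h2.
  have : (1 - s) * (C1 * e) <= C1 * e.
    by rewrite ler_piMl ?(mulr_ge0 (ltW C10)) ?(ltW e0) // lerBlDr lerDl ltW.
  have : s * (C2 * e) <= C2 * e by rewrite ler_piMl ?(mulr_ge0 (ltW C20)) ?(ltW e0).
  rewrite {}FE; nra.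
have -> : b - f_eps x e u = (1 - s) *: (b - o).
  by rewrite fE' scalerBr [(1 - s) *: b]scalerBl scale1r opprD addrA addrAC.
rewrite normrZ ger0_norm ?subr_ge0 //.
rewrite [leRHS](_ : _ = (2 / r * ((C1 + C2) * e)) * `|b - o|); last by ring.
rewrite ler_wpM2r //.
rewrite [2 / r]mulrC -mulrA ler_pdivlMl //; lra.
Qed.

Lemma boundary_limit b : boundary K b -> exists2 y : R -> 'rV[R]_d,
  (forall e, 0 < e -> (f_eps x e @` unit_sphere) (y e)) & y e @[e --> 0^'+] --> b.
Proof.
move=> /f_eps_close[D [e0 [D0 e0_gt0 [u0 u01] close]]].
have /choice[y yP] : forall e : R, exists z, 0 < e ->
    (f_eps x e @` unit_sphere) z /\ (e < e0 -> `|b - z| <= D * e).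
  (* For e >= e0 any value of f_eps x e will do. *)
  move=> e; have [lt_e|ge_e] := ltP e e0; last first.
    exists (f_eps x e u0) => _; split => //; exact: imageP.
  have [e_gt0|] := boolP (0 < e); last by exists b.
  have [|u u1 fu] := close e; first by rewrite e_gt0.
  exists (f_eps x e u) => _; split => //; exact: imageP.
exists y => [e /yP[]//|].
apply/cvgrPdist_le => eps eps0; near=> e.
have e_gt0 : 0 < e by near: e; exact: nbhs_right_gt.
have lt_e : e < e0 by near: e; exact: nbhs_right_lt.
have [_ /(_ lt_e) yb] := yP e e_gt0; apply: le_trans yb _.
rewrite mulrC -ler_pdivlMr //; near: e; apply: nbhs_right_le.
by rewrite divr_gt0.
Unshelve. all: by end_near. Qed.

End Nondegenerate.

Unset Implicit Arguments.

Theorem theorem2p1 (R : realType) (n d : nat) (x : 'I_n -> 'rV[R]_d)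
    (hn : (d.+1 <= n)%N) (x_distinct : injective x)
    (x_nondegenerate : nondegenerate_config x) :
  let K := convex_hull (range x) in
  has_affine_dim K d /\
  (forall e : R, 0 < e -> f_eps x e @` unit_sphere `<=` K°) /\
  sets_converge_at_right0 (fun e : R => f_eps x e @` unit_sphere)
    (boundary K).
Proof.
move=> K; have n_gt0 : (0 < n)%N by apply: leq_ltn_trans hn.
split; [|split; [|split]].
- exists 0, fullv; split; last by rewrite dimvf /dim /= mul1n.
  rewrite affine_hull_setT //.
  by apply/seteqP; split => // y _; rewrite /affine_of /= memvf.
- by move=> e e0 _ [u _ <-]; exact: f_eps_interior.
- by move=> W; exact: f_eps_near_boundary.
- by move=> b; exact: boundary_limit.
Qed.
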